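(* For any string $\sigma\in 2^{<\omega}$ and any set $A \subseteq \mathbb{N}$, \[ C(\sigma \mid [A]^\omega \cup [\mathbb{N}\setminus A]^\omega) \geq C^{0'}(\sigma) - O(1), \] where the constant hidden by the $O(1)$ does not depend on $\sigma$ or $A$.
   Context: $C$ denotes plain Kolmogorov complexity and $C^Y$ Kolmogorov complexity relative to oracle $Y$; $0'$ is the halting problem. $[B]^\omega$ is the family of infinite subsets of $B$. For a family $\mathcal{F}$ of subsets of $\mathbb{N}$, $C(\sigma \mid \mathcal{F}) = \max_{Y \in \mathcal{F}} C^Y(\sigma)$. *)

(* Defs.v *)
From mathcomp Require Import all_boot.
From mathcomp Require Import boolp classical_sets functions cardinality.

Set Implicit Arguments.
Unset Strict Implicit.
Unset Printing Implicit Defensive.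

Local Open Scope classical_set_scope.

(* Cantor's bijection: 'C(s.+1, 2) = s * (s + 1) / 2. *)
Definition npair (x y : nat) : nat := 'C((x + y).+1, 2) + y.

(* Partial recursive functions relative to an oracle, as unary functions on
   nat, several arguments being packed with npair. *)
Inductive code : Type :=
| Zero
| Succ
| Fst
| Snd
| Query
| Pair of code & code
| Comp of code & code
| Prec of code & code
| Mu of code.

Fixpoint prec_graph (F G : nat -> nat -> Prop) (a n v : nat) : Prop :=
  match n with
  | 0 => F a v
  | n'.+1 => exists2 w, prec_graph F G a n' w & G (npair a (npair n' w)) v
  end.

(* [eval Y c x v]: the function computed by c with oracle Y is defined at x,
   with value v. *)
Fixpoint eval (Y : set nat) (c : code) (x v : nat) : Prop :=
  match c with
  | Zero => v = 0
  | Succ => v = x.+1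
  | Fst => exists b, x = npair v b
  | Snd => exists a, x = npair a v
  | Query => v = `[< Y x >] :> nat
  | Pair f g => exists a b, [/\ eval Y f x a, eval Y g x b & v = npair a b]
  | Comp f g => exists2 w, eval Y g x w & eval Y f w v
  | Prec f g => exists a n,
      x = npair a n /\ prec_graph (eval Y f) (eval Y g) a n v
  | Mu f => eval Y f (npair x v) 0 /\
      (forall m, m < v -> exists w, eval Y f (npair x m) w.+1)
  end.

Fixpoint godel (c : code) : nat :=
  match c with
  | Zero => 0
  | Succ => 1
  | Fst => 2
  | Snd => 3
  | Query => 4
  | Pair f g => 4 * npair (godel f) (godel g) + 5
  | Comp f g => 4 * npair (godel f) (godel g) + 6
  | Prec f g => 4 * npair (godel f) (godel g) + 7
  | Mu f => 4 * godel f + 8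
  end.

(* 0' = { <e, x> | phi_e(x) is defined }, phi_e being unrelativized. *)
Definition halting_problem : set nat :=
  [set n | exists c x v, n = npair (godel c) x /\ eval set0 c x v].

(* Bijective binary numeration, identifying 2^{<omega} with nat. *)
Fixpoint str_num (s : seq bool) : nat :=
  if s is b :: s' then (str_num s').*2 + b.+1 else 0.

(* [run M Y p s]: the oracle machine M outputs s on program p with oracle Y. *)
Definition run (M : code) (Y : set nat) (p s : seq bool) : Prop :=
  eval Y M (str_num p) (str_num s).

(* Additively optimal oracle machines; the constant k does not depend on the
   oracle. *)
Definition optimal (U : code) : Prop :=
  forall M : code, exists k : nat, forall (Y : set nat) (p s : seq bool),
    run M Y p s -> exists2 q, size q <= size p + k & run U Y q s.

(* C^Y(s) with reference machine U.  The default value 0 is never taken when U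
   is optimal: see plainCP. *)
Definition plainC (U : code) (Y : set nat) (s : seq bool) : nat :=
  xget 0 [set n | (exists2 p, size p = n & run U Y p s) /\
                  (forall p, run U Y p s -> n <= size p)].

(* C(s | F), the maximum of C^Y(s) for Y in F.  The default value 0 is never
   taken when U is optimal and F is nonempty: see plainC_familyP. *)
Definition plainC_family (U : code) (F : set (set nat)) (s : seq bool) : nat :=
  xget 0 [set m | (exists2 Y, F Y & plainC U Y s = m) /\
                  (forall Y, F Y -> plainC U Y s <= m)].

Definition infinite_subsets (B : set nat) : set (set nat) :=
  [set Y | Y `<=` B /\ infinite_set Y].

Lemma npair_surj n : exists x y, n = npair x y.
Proof.
elim: n => [|n [[|x] [y ->]]]; first by exists 0, 0.
- exists y.+1, 0.
  by rewrite /npair addn0 add0n [in RHS]addn0 [in RHS]binS bin1 addnS.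
- exists x, y.+1.
  by rewrite /npair addSnnS [RHS]addnS.
Qed.

Lemma optimal_bound U : optimal U -> exists k : nat,
  forall (Y : set nat) (s : seq bool), exists2 p, size p <= size s + k & run U Y p s.
Proof.
move=> /(_ (Pair Fst Snd)) [k hk]; exists k => Y s; apply: (hk Y s s).
have [x [y e]] := npair_surj (str_num s).
by exists x, y; split=> //; [exists y | exists x].
Qed.

Lemma plainCP U : optimal U -> forall (Y : set nat) (s : seq bool),
  (exists2 p, size p = plainC U Y s & run U Y p s) /\
  (forall p, run U Y p s -> plainC U Y s <= size p).
Proof.
move=> /optimal_bound[k hk] Y s.
have exP : exists n, `[< exists2 p, size p = n & run U Y p s >].
  by have [p _ hp] := hk Y s; exists (size p); apply/asboolP; exists p.
case: (ex_minnP exP) => n /asboolP hn hmin.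
rewrite /plainC; case: xgetP => [m _ //|/(_ n)[]]; split=> // p hp.
by apply: hmin; apply/asboolP; exists p.
Qed.

Lemma plainC_familyP U (F : set (set nat)) : optimal U -> F !=set0 ->
  forall s : seq bool,
  (exists2 Y, F Y & plainC U Y s = plainC_family U F s) /\
  (forall Y, F Y -> plainC U Y s <= plainC_family U F s).
Proof.
move=> hU [Y0 FY0] s; have [k hk] := optimal_bound hU.
have exP : exists n, `[< exists2 Y, F Y & plainC U Y s = n >].
  by exists (plainC U Y0 s); apply/asboolP; exists Y0.
have bP n : `[< exists2 Y, F Y & plainC U Y s = n >] -> n <= size s + k.
  move=> /asboolP[Y _ <-]; have [p hp rp] := hk Y s.
  by apply: leq_trans hp; apply: (plainCP hU Y s).2.
case: (ex_maxnP exP bP) => n /asboolP hn hmax.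
rewrite /plainC_family; case: xgetP => [m _ //|/(_ n)[]]; split=> // Y FY.
by apply: hmax; apply/asboolP; exists Y.
Qed.

Lemma infinite_subsetsUC_neq0 (A : set nat) :
  infinite_subsets A `|` infinite_subsets (~` A) !=set0.
Proof.
have [fA|iA] := pselect (finite_set A); last by exists A; left; split.
exists (~` A); right; split=> // fCA; apply: infinite_nat.
by rewrite -(setUv A) finite_setU.
Qed.

(* Main.v *)
Require Import Defs.
From mathcomp Require Import all_boot.
From mathcomp Require Import boolp classical_sets functions cardinality.
From mathcomp Require Import zify.

Local Open Scope classical_set_scope.

(** Fix N = 2 ^ n.+1 - 1, the number of programs of length at most n, and for a
    finite set E let D(E) be the set of outputs of these programs with oracle E
    (with queries and running time bounded).  Call a finite list V good if, for
    some b, there is a colouring of nat by b + 1 colours such that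
    |D(E) u V| <= N for every monochromatic finite E above b.  By compactness
    this is a Pi_1 property of b and V, so 0' can build a list greedily,
    adding an element whenever some b shows that the longer list is good.  A
    good list has at most N elements, so the process stabilises at some V.

    If t has a description of length at most n relative to every infinite subset
    of A or of its complement, then t is in V.  Indeed, refine the colouring of
    V by A and drop the finite colour classes: a monochromatic E then extends to
    an infinite monochromatic Y contained in A or its complement, so t is in
    D(E') for some initial segment E' of Y extending E, and |D(E') u V| <= N
    gives |D(E) u V u {t}| <= N.  Hence t can be added to V.

    The i-th element of the list (i < N) is therefore described relative to 0'
    by the number N + i, which is a string of length n + 1. *)

(** * Pairing and numbering *)

(** Pairs on the diagonal [x + y = s] get the codes from ['C(s.+1, 2)] up to but excluding
    ['C(s.+2, 2)], so different diagonals never meet. *)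
Lemma npair_inj2 x y x' y' : npair x y = npair x' y' -> x = x' /\ y = y'.
Proof.
rewrite /npair.
have lt_diag s s' t t' : t <= s -> s < s' -> 'C(s.+1, 2) + t < 'C(s'.+1, 2) + t'.
  move=> ts ss'; apply: (@leq_trans 'C(s.+2, 2)).
    by rewrite [ltnRHS]binS bin1; lia.
  by apply: leq_trans (leq_addr _ _); apply: leq_bin2l.
have [ss'|ss'|ss'] := ltngtP (x + y) (x' + y').
- by have := @lt_diag _ _ y y' (leq_addl _ _) ss'; lia.
- by have := @lt_diag _ _ y' y (leq_addl _ _) ss'; lia.
- by rewrite ss'; lia.
Qed.

Lemma leq_npairl x y : x <= npair x y.
Proof.
apply: leq_trans (leq_addr _ _).
by rewrite binS bin1 addnCA leq_addr.
Qed.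

Definition pfst (n : nat) : nat := sval (cid (npair_surj n)).
Definition psnd (n : nat) : nat := sval (cid (svalP (cid (npair_surj n)))).

Lemma npairK n : npair (pfst n) (psnd n) = n.
Proof. by rewrite -(svalP (cid (svalP (cid (npair_surj n))))). Qed.

Lemma pfst_npair x y : pfst (npair x y) = x.
Proof. by have /npair_inj2[] := npairK (npair x y). Qed.

Lemma psnd_npair x y : psnd (npair x y) = y.
Proof. by have /npair_inj2[] := npairK (npair x y). Qed.

(** Residues modulo 4 separate the compound constructors, and the constants lie below 5. Injectivity
    lets a code be read back from an element of [halting_problem]. *)
Lemma godel_inj : injective godel.
Proof.
elim=> [||||| f IHf g IHg | f IHf g IHg | f IHf g IHg | f IHf]
  [||||| f' g' | f' g' | f' g' | f'] //= e; try by lia.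
- have /npair_inj2[/IHf -> /IHg -> //] : npair (godel f) (godel g) = npair (godel f') (godel g') by lia.
- have /npair_inj2[/IHf -> /IHg -> //] : npair (godel f) (godel g) = npair (godel f') (godel g') by lia.
- have /npair_inj2[/IHf -> /IHg -> //] : npair (godel f) (godel g) = npair (godel f') (godel g') by lia.
- by rewrite (IHf f') //; lia.
Qed.

Lemma str_num_bounds p : (2 ^ size p).-1 <= str_num p < (2 ^ (size p).+1).-1.
Proof.
elim: p => [//|b p]; rewrite [size _]/= [str_num _]/= !expnS.
have : 0 < 2 ^ size p by rewrite expn_gt0.
by move: (2 ^ size p) => k; case: b => /=; lia.
Qed.

Lemma str_num_surj x : exists p, str_num p = x.
Proof.
elim/ltn_ind: x => [[|x] IH]; first by exists [::].
have [|p hp] := IH x./2; first by lia.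
by exists (odd x :: p); rewrite /= hp; lia.
Qed.

Lemma str_num_surj_size k x : (2 ^ k).-1 <= x < (2 ^ k.+1).-1 ->
  exists2 p, size p = k & str_num p = x.
Proof.
move=> hx; have [p hp] := str_num_surj x; exists p => //.
have := str_num_bounds p; rewrite hp => hp'.
have [lt|lt|//] := ltngtP (size p) k.
- have : 2 ^ (size p).+1 <= 2 ^ k by rewrite leq_exp2l.
  by lia.
- have : 2 ^ k.+1 <= 2 ^ size p by rewrite leq_exp2l.
  by lia.
Qed.

(** * Bounded evaluation *)

Lemma eventually_ltn (P : nat -> nat -> Prop) :
  (forall q, exists s0, forall s, s0 <= s -> P q s) ->
  forall N, exists s0, forall q s, q < N -> s0 <= s -> P q s.
Proof.
move=> /choice[u hu] N; exists (\max_(q < N) u q) => q s qN hs.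
apply: hu; apply: leq_trans hs; exact: (leq_bigmax (Ordinal qN)).
Qed.

(* The first m <= s such that P fails at m, or s if there is none. *)
Definition first_fail (P : pred nat) (s : nat) : nat :=
  iteri s (fun i w => if (w == i) && P i then i.+1 else w) 0.

Lemma first_fail_lt (P : pred nat) s m : m < first_fail P s -> P m.
Proof.
elim: s m => [//|s IH] m; rewrite /first_fail iteriS -/(first_fail P s).
case: ifP => [/andP[/eqP e Ps]|_]; last exact: IH.
by rewrite ltnS leq_eqVlt => /orP[/eqP ->//|ms]; apply: IH; rewrite e.
Qed.

(** The accumulator follows the loop index up to [m]; there it does not move, and from then on it
    lags behind for good. *)
Lemma first_failE (P : pred nat) s m : m < s -> ~~ P m ->
  (forall i, i < m -> P i) -> first_fail P s = m.
Proof.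
have lo t : (forall i, i < t -> P i) -> first_fail P t = t.
  elim: t => [//|t IH] h; rewrite /first_fail iteriS -/(first_fail P t).
  by rewrite IH ?eqxx ?h // => i it; apply: h; lia.
move=> ms nPm hm; elim: s ms => [//|s IH].
rewrite ltnS leq_eqVlt /first_fail iteriS -/(first_fail P s) => /orP[/eqP e|ms].
  by rewrite -e lo // (negbTE nPm) andbF.
by rewrite IH //; case: eqP => //= e; move: ms; rewrite e ltnn.
Qed.

(* [beval c s o x]: 0 if the computation does not terminate within the bound
   s, v.+1 if it yields v; only oracle queries below s are answered. *)
Fixpoint beval (c : code) (s : nat) (o : pred nat) (x : nat) : nat :=
  match c with
  | Zero => 1
  | Succ => x.+2
  | Fst => (pfst x).+1
  | Snd => (psnd x).+1
  | Query => if x < s then (o x).+1 else 0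
  | Pair f g =>
      if (beval f s o x == 0) || (beval g s o x == 0) then 0
      else (npair (beval f s o x).-1 (beval g s o x).-1).+1
  | Comp f g =>
      if beval g s o x == 0 then 0 else beval f s o (beval g s o x).-1
  | Prec f g =>
      iteri (psnd x)
        (fun i w => if w == 0 then 0
                    else beval g s o (npair (pfst x) (npair i w.-1)))
        (beval f s o (pfst x))
  | Mu f =>
      let m := first_fail (fun i => 1 < beval f s o (npair x i)) s in
      if beval f s o (npair x m) == 1 then m.+1 else 0
  end.

(** A query at or above [s] counts as divergence, so the oracle is only ever consulted below [s]. *)
Lemma eq_beval c s (o o' : pred nat) x : (forall i, i < s -> o i = o' i) ->
  beval c s o x = beval c s o' x.
Proof.
move=> e; elim: c x => //= [|f IHf g IHg|f IHf g IHg|f IHf g IHg|f IHf] x.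
- by case: ifP => // xs; rewrite e.
- by rewrite IHf IHg.
- by rewrite IHg IHf.
- rewrite IHf; elim: (psnd x) => //= n ->.
  by case: ifP => // _; rewrite IHg.
- have -> : first_fail (fun i => 1 < beval f s o (npair x i)) s =
            first_fail (fun i => 1 < beval f s o' (npair x i)) s.
    by congr first_fail; apply/funext => i; rewrite IHf.
  by rewrite IHf.
Qed.

Lemma beval_sound (Y : set nat) c s (o : pred nat) x v :
  (forall i, i < s -> o i = `[< Y i >]) -> beval c s o x = v.+1 -> eval Y c x v.
Proof.
move=> ho; elim: c x v => [||||| f IHf g IHg | f IHf g IHg | f IHf g IHg | f IHf] x v /=.
- by case.
- by case.
- by case=> <-; exists (psnd x); rewrite npairK.
- by case=> <-; exists (pfst x); rewrite npairK.
- by case: ifP => // xs [<-]; rewrite ho.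
- case: eqP => //= /eqP; rewrite -lt0n => /prednK hf.
  case: eqP => //= /eqP; rewrite -lt0n => /prednK hg [<-].
  exists (beval f s o x).-1, (beval g s o x).-1.
  by split=> //; [apply: IHf; rewrite hf|apply: IHg; rewrite hg].
- case: eqP => //= /eqP; rewrite -lt0n => /prednK hg hf.
  by exists (beval g s o x).-1; [apply: IHg; rewrite hg|apply: IHf].
- move=> h; exists (pfst x), (psnd x); rewrite npairK; split=> //.
  move: h; set step := (X in iteri _ X _).
  elim: (psnd x) v => [|n IH] v /=; first exact: IHf.
  rewrite {1}/step; case: eqP => //= /eqP; rewrite -lt0n => /prednK hw hv.
  by exists (iteri n step (beval f s o (pfst x))).-1;
    [apply: IH; rewrite hw|apply: IHg].
- set m := first_fail _ _; case: eqP => // hm [<-]; split; first exact: IHf.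
  (* A bounded value above 1 stands for a nonzero result, whose predecessor is the bounded value
     minus 2. *)
  move=> i /first_fail_lt hi; exists (beval f s o (npair x i)).-2.
  by apply: IHf; lia.
Qed.

(** The bound serves all larger [s], so the bounds of subcomputations combine by maximum; for [Mu]
    these include the finitely many values before the search stops. *)
Lemma beval_complete (Y : set nat) c x v : eval Y c x v ->
  exists s0, forall s, s0 <= s -> forall o : pred nat,
    (forall i, i < s -> o i = `[< Y i >]) -> beval c s o x = v.+1.
Proof.
elim: c x v => [||||| f IHf g IHg | f IHf g IHg | f IHf g IHg | f IHf] x v /=.
- by move=> ->; exists 0.
- by move=> ->; exists 0.
- by move=> [b ->]; exists 0 => *; rewrite pfst_npair.
- by move=> [b ->]; exists 0 => *; rewrite psnd_npair.
- by move=> ->; exists x.+1 => s xs o ho; rewrite xs ho.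
- move=> [a [b [/IHf[sf hf] /IHg[sg hg] ->]]]; exists (maxn sf sg) => s.
  by rewrite geq_max => /andP[h1 h2] o ho; rewrite hf // hg.
- move=> [w /IHg[sg hg] /IHf[sf hf]]; exists (maxn sf sg) => s.
  by rewrite geq_max => /andP[h1 h2] o ho; rewrite hg // hf.
- move=> [a [n [-> h]]]; rewrite pfst_npair psnd_npair.
  elim: n v h => [|n IH] v /=; first exact: IHf.
  move=> [w /IH[sw hw] /IHg[sg hg]]; exists (maxn sw sg) => s.
  by rewrite geq_max => /andP[h1 h2] o ho; rewrite hw // hg.
- move=> [/IHf[s1 h1] h2].
  have [q|s2 hs2] := @eventually_ltn (fun i s => i < v -> forall o : pred nat,
    (forall j, j < s -> o j = `[< Y j >]) -> 1 < beval f s o (npair x i)) _ v.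
    have [qv|qv] := ltnP q v; last by exists 0.
    have [w /IHf[s0 hs0]] := h2 q qv; exists s0 => s hs _ o ho.
    by rewrite hs0.
  exists (maxn (maxn s1 s2) v.+1) => s.
  rewrite !geq_max -andbA => /and3P[l1 l2 l3] o ho.
  rewrite (@first_failE _ _ v) ?h1 // => i iv; exact: hs2.
Qed.

Lemma beval_complete_ltn (Y : set nat) c N : exists s0, forall q s v,
  q < N -> s0 <= s -> eval Y c q v -> forall o : pred nat,
  (forall i, i < s -> o i = `[< Y i >]) -> beval c s o q = v.+1.
Proof.
have [q|s0 hs0] := @eventually_ltn (fun q s => forall v, eval Y c q v ->
  forall o : pred nat, (forall i, i < s -> o i = `[< Y i >]) ->
  beval c s o q = v.+1) _ N; last first.
  by exists s0 => q s v qN hs; apply: hs0.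
have [[v hv]|nv] := pselect (exists v, eval Y c q v); last first.
  by exists 0 => s _ v hv; case: nv; exists v.
have [s0 hs0] := beval_complete _ _ _ _ hv; exists s0 => s hs v' hv' o ho.
have [s1 hs1] := beval_complete _ _ _ _ hv'; rewrite hs0 //.
(* Values are unique: with the true oracle, both evaluations succeed at the larger of the two
   bounds. *)
pose t := maxn s0 s1; have := hs0 t (leq_maxl _ _) (fun i => `[< Y i >]) (fun _ _ => erefl).
by rewrite hs1 ?leq_maxr.
Qed.

(** * Total computable functions relative to an oracle *)

(** The equivalence bundles totality with uniqueness of the value. Predicates are treated as
    functions with values 0 and 1. *)
Definition computable (Y : set nat) (f : nat -> nat) : Prop :=
  exists c, forall x v, eval Y c x v <-> v = f x.

Lemma eq_computable Y f g : f =1 g -> computable Y f -> computable Y g.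
Proof. by move=> /funext ->. Qed.

Lemma computable_comp Y f g : computable Y f -> computable Y g ->
  computable Y (fun x => f (g x)).
Proof.
move=> [cf hf] [cg hg]; exists (Comp cf cg) => x v /=; split.
  by move=> [w /hg -> /hf].
by move=> ->; exists (g x); [apply/hg|apply/hf].
Qed.

Lemma computable_npair Y f g : computable Y f -> computable Y g ->
  computable Y (fun x => npair (f x) (g x)).
Proof.
move=> [cf hf] [cg hg]; exists (Pair cf cg) => x v /=; split.
  by move=> [a [b [/hf -> /hg -> ->]]].
by move=> ->; exists (f x), (g x); split=> //; [apply/hf|apply/hg].
Qed.

Lemma computable_pfst Y f : computable Y f -> computable Y (fun x => pfst (f x)).
Proof.
apply: computable_comp; exists Fst => x v /=; split.
  by move=> [b ->]; rewrite pfst_npair.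
by move=> ->; exists (psnd x); rewrite npairK.
Qed.

Lemma computable_psnd Y f : computable Y f -> computable Y (fun x => psnd (f x)).
Proof.
apply: computable_comp; exists Snd => x v /=; split.
  by move=> [b ->]; rewrite psnd_npair.
by move=> ->; exists (pfst x); rewrite npairK.
Qed.

Lemma computable_id Y : computable Y (fun x => x).
Proof.
apply: (@eq_computable Y (fun x => npair (pfst x) (psnd x))).
  by move=> x; rewrite npairK.
by apply: computable_npair; [exists Fst|exists Snd] => x v /=; split;
  [move=> [b ->]; rewrite pfst_npair|move=> ->; exists (psnd x); rewrite npairK
  |move=> [b ->]; rewrite psnd_npair|move=> ->; exists (pfst x); rewrite npairK].
Qed.

Lemma computable_succ Y f : computable Y f -> computable Y (fun x => (f x).+1).
Proof. by apply: (@computable_comp Y succn); exists Succ. Qed.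

Lemma computable_const Y n : computable Y (fun=> n).
Proof. by elim: n => [|n IH]; [exists Zero|apply: computable_succ]. Qed.

Lemma computable_query Y f : computable Y f ->
  computable Y (fun x => nat_of_bool `[< Y (f x) >]).
Proof. by apply: (@computable_comp Y (fun x => nat_of_bool `[< Y x >])); exists Query. Qed.

(** [Prec] loops on inputs [npair a n]; the general loop follows by composition with the map sending
    [x] to [npair x (n x)]. *)
Lemma computable_iteri Y (n f : nat -> nat) (g : nat -> nat -> nat -> nat) :
  computable Y n -> computable Y f ->
  computable Y (fun z => g (pfst z) (pfst (psnd z)) (psnd (psnd z))) ->
  computable Y (fun x => iteri (n x) (g x) (f x)).
Proof.
move=> hn [cf hf] [cg hg].
suff h : computable Y (fun z => iteri (psnd z) (g (pfst z)) (f (pfst z))).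
  have := computable_comp _ _ _ h (computable_npair _ _ _ (computable_id Y) hn).
  by apply: eq_computable => x /=; rewrite pfst_npair psnd_npair.
exists (Prec cf cg) => x v /=.
suff h a k w : prec_graph (eval Y cf) (eval Y cg) a k w <-> w = iteri k (g a) (f a).
  split=> [[a [k [-> /h]]]|e]; first by rewrite pfst_npair psnd_npair.
  by exists (pfst x), (psnd x); rewrite npairK; split=> //; apply/h.
elim: k w => [|k IH] w /=; first exact: hf.
split=> [[u /IH -> /hg ->]|->].
  by rewrite !(pfst_npair, psnd_npair).
exists (iteri k (g a) (f a)); first exact/IH.
by apply/hg; rewrite !(pfst_npair, psnd_npair).
Qed.

Lemma computable_addn Y f g : computable Y f -> computable Y g ->
  computable Y (fun x => f x + g x).
Proof.
move=> hf hg; apply: (@eq_computable Y (fun x => iteri (f x) (fun _ w => w.+1) (g x))).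
  by move=> x; elim: (f x) => //= n ->.
apply: computable_iteri => //=.
by apply: computable_succ; do 2!apply: computable_psnd; exact: computable_id.
Qed.

Lemma computable_muln Y f g : computable Y f -> computable Y g ->
  computable Y (fun x => f x * g x).
Proof.
move=> hf hg.
apply: (@eq_computable Y (fun x => iteri (f x) (fun _ w => g x + w) 0)).
  by move=> x; elim: (f x) => //= n ->; rewrite mulSn.
apply: computable_iteri => //=; first exact: computable_const.
apply: computable_addn; last by do 2!apply: computable_psnd; exact: computable_id.
by apply: (computable_comp _ g) => //; apply: computable_pfst; exact: computable_id.
Qed.

Lemma computable_predn Y f : computable Y f -> computable Y (fun x => (f x).-1).
Proof.
move=> hf; apply: (@eq_computable Y (fun x => iteri (f x) (fun i _ => i) 0)).
  by move=> x; case: (f x).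
apply: computable_iteri => //=; first exact: computable_const.
by apply: computable_pfst; apply: computable_psnd; exact: computable_id.
Qed.

Lemma computable_subn Y f g : computable Y f -> computable Y g ->
  computable Y (fun x => f x - g x).
Proof.
move=> hf hg; apply: (@eq_computable Y (fun x => iteri (g x) (fun _ w => w.-1) (f x))).
  by move=> x; elim: (g x) => [|n /= ->]; rewrite ?subn0 // subnS.
apply: computable_iteri => //=; apply: computable_predn.
by do 2!apply: computable_psnd; exact: computable_id.
Qed.

Lemma computable_expn Y f g : computable Y f -> computable Y g ->
  computable Y (fun x => f x ^ g x).
Proof.
move=> hf hg.
apply: (@eq_computable Y (fun x => iteri (g x) (fun _ w => f x * w) 1)).
  by move=> x; elim: (g x) => //= n ->; rewrite expnS.
apply: computable_iteri => //=; first exact: computable_const.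
apply: computable_muln; last by do 2!apply: computable_psnd; exact: computable_id.
by apply: (computable_comp _ f) => //; apply: computable_pfst; exact: computable_id.
Qed.

Lemma computable_negb Y (P : pred nat) : computable Y P -> computable Y (fun x => ~~ P x).
Proof.
move=> h; apply: (@eq_computable Y (fun x => 1 - P x)); first by move=> x; case: (P x).
by apply: computable_subn => //; exact: computable_const.
Qed.

Lemma computable_leq Y f g : computable Y f -> computable Y g ->
  computable Y (fun x => f x <= g x).
Proof.
move=> hf hg; apply: (@eq_computable Y (fun x => 1 - (f x - g x))).
  by move=> x; case: leqP; lia.
by apply: computable_subn; [exact: computable_const|exact: computable_subn].
Qed.

Lemma computable_andb Y (P Q : pred nat) : computable Y P -> computable Y Q ->
  computable Y (fun x => P x && Q x).
Proof.
move=> hP hQ; apply: (@eq_computable Y (fun x => P x * Q x)).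
  by move=> x; case: (P x); case: (Q x).
exact: computable_muln.
Qed.

Lemma computable_orb Y (P Q : pred nat) : computable Y P -> computable Y Q ->
  computable Y (fun x => P x || Q x).
Proof.
move=> hP hQ; apply: (@eq_computable Y (fun x => ~~ (~~ P x && ~~ Q x))).
  by move=> x; case: (P x); case: (Q x).
by apply: computable_negb; apply: computable_andb; exact: computable_negb.
Qed.

Lemma computable_eqn Y f g : computable Y f -> computable Y g ->
  computable Y (fun x => f x == g x).
Proof.
move=> hf hg; apply: (@eq_computable Y (fun x => (f x <= g x) && (g x <= f x))).
  by move=> x; rewrite -eqn_leq.
by apply: computable_andb; exact: computable_leq.
Qed.

Lemma computable_if Y (P : pred nat) f g : computable Y P -> computable Y f ->
  computable Y g -> computable Y (fun x => if P x then f x else g x).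
Proof.
move=> hP hf hg; apply: (@eq_computable Y (fun x => P x * f x + (~~ P x) * g x)).
  by move=> x; case: (P x) => /=; lia.
by apply: computable_addn; apply: computable_muln => //; exact: computable_negb.
Qed.

Lemma computable_count Y (n : nat -> nat) (P : nat -> pred nat) : computable Y n ->
  computable Y (fun z => P (pfst z) (psnd z)) ->
  computable Y (fun x => count (P x) (iota 0 (n x))).
Proof.
move=> hn hP.
apply: (@eq_computable Y (fun x => iteri (n x) (fun i w => w + P x i) 0)).
  move=> x; elim: (n x) => //= k ->.
  by rewrite -[RHS]/(count _ (iota 0 k.+1)) -addn1 iotaD count_cat /= addn0.
apply: computable_iteri => //=; first exact: computable_const.
apply: computable_addn; first by do 2!apply: computable_psnd; exact: computable_id.
have hid := computable_id Y.
have := computable_comp _ _ _ hP (computable_npair _ _ _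
  (computable_pfst _ _ hid) (computable_pfst _ _ (computable_psnd _ _ hid))).
by apply: eq_computable => z /=; rewrite pfst_npair psnd_npair.
Qed.

Lemma computable_has Y (n : nat -> nat) (P : nat -> pred nat) : computable Y n ->
  computable Y (fun z => P (pfst z) (psnd z)) ->
  computable Y (fun x => has (P x) (iota 0 (n x))).
Proof.
move=> hn hP; apply: (@eq_computable Y (fun x => 0 < count (P x) (iota 0 (n x)))).
  by move=> x; rewrite has_count.
by apply: computable_leq; [exact: computable_const|exact: computable_count].
Qed.

Lemma computable_all Y (n : nat -> nat) (P : nat -> pred nat) : computable Y n ->
  computable Y (fun z => P (pfst z) (psnd z)) ->
  computable Y (fun x => all (P x) (iota 0 (n x))).
Proof.
move=> hn hP.
apply: (@eq_computable Y (fun x => ~~ has (fun i => ~~ P x i) (iota 0 (n x)))).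
  by move=> x; rewrite -all_predC; congr nat_of_bool; apply: eq_all => i /=; rewrite negbK.
by apply: computable_negb; apply: computable_has => //; exact: computable_negb.
Qed.

(** For a nonzero divisor, the quotient counts the positive multiples of [g x] up to [f x]. *)
Lemma computable_divn Y f g : computable Y f -> computable Y g ->
  computable Y (fun x => f x %/ g x).
Proof.
move=> hf hg; apply: (@eq_computable Y (fun x => if g x == 0 then 0 else
    count (fun i => i.+1 * g x <= f x) (iota 0 (f x)))).
  move=> x; case: posnP => [->|g0]; first by rewrite divn0.
  rewrite -[RHS](size_iota 0) -size_filter.
  suff -> : [seq i <- iota 0 (f x) | i.+1 * g x <= f x] = iota 0 (f x %/ g x) by [].
  apply: (irr_sorted_eq ltn_trans ltnn) => [||i].
  - by apply: sorted_filter (iota_ltn_sorted _ _); exact: ltn_trans.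
  - exact: iota_ltn_sorted.
  - rewrite mem_filter !mem_iota /= !add0n leq_divRL // andb_idr //.
    by move=> h; apply: leq_trans h; rewrite leq_pmulr.
have [hid h0] := (computable_id Y, computable_const Y 0).
apply: computable_if => //; first exact: computable_eqn.
apply: computable_count => //; apply: computable_leq; last first.
  by apply: (computable_comp _ f) => //; exact: computable_pfst.
apply: computable_muln; first by apply: computable_succ; exact: computable_psnd.
by apply: (computable_comp _ g) => //; exact: computable_pfst.
Qed.

Lemma computable_modn Y f g : computable Y f -> computable Y g ->
  computable Y (fun x => f x %% g x).
Proof.
move=> hf hg; apply: (@eq_computable Y (fun x => f x - f x %/ g x * g x)).
  by move=> x; rewrite {1}(divn_eq (f x) (g x)) addKn.
apply: computable_subn => //; apply: computable_muln => //; exact: computable_divn.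
Qed.

Ltac computability := repeat (cbv beta; match goal with
  | h : computable ?Y ?f |- computable ?Y ?f => exact: h
  | |- computable _ (fun x => x) => apply: computable_id
  | |- computable ?Y (fun _ => ?c) => exact: (computable_const Y c)
  | |- computable ?Y pfst => exact: (computable_pfst Y _ (computable_id Y))
  | |- computable ?Y psnd => exact: (computable_psnd Y _ (computable_id Y))
  | |- computable _ (fun x => npair _ _) => apply: computable_npair
  | |- computable _ (fun x => pfst _) => apply: computable_pfst
  | |- computable _ (fun x => psnd _) => apply: computable_psnd
  | |- computable _ (fun x => nat_of_bool (~~ _)) => apply: computable_negb
  | |- computable _ (fun x => nat_of_bool (_ && _)) => apply: computable_andb
  | |- computable _ (fun x => nat_of_bool (_ || _)) => apply: computable_orb
  | |- computable _ (fun x => nat_of_bool (_ == _)) => apply: computable_eqn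
  | |- computable _ (fun x => nat_of_bool (_ <= _)) => apply: computable_leq
  | |- computable _ (fun x => nat_of_bool (has _ (iota 0 _))) => apply: computable_has
  | |- computable _ (fun x => nat_of_bool (all _ (iota 0 _))) => apply: computable_all
  | |- computable _ (fun x => count _ (iota 0 _)) => apply: computable_count
  | |- computable _ (fun x => _.+1) => apply: computable_succ
  | |- computable _ (fun x => _.-1) => apply: computable_predn
  | |- computable _ (fun x => _ + _) => apply: computable_addn
  | |- computable _ (fun x => _ - _) => apply: computable_subn
  | |- computable _ (fun x => _ * _) => apply: computable_muln
  | |- computable _ (fun x => _ ^ _) => apply: computable_expn
  | |- computable _ (fun x => _ %/ _) => apply: computable_divn
  | |- computable _ (fun x => _ %% _) => apply: computable_modn
  | |- computable _ (fun x => if _ then _ else _) => apply: computable_if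
  | |- computable _ (fun x => iteri _ _ _) => apply: computable_iteri
  | h : computable ?Y ?f |- computable ?Y (fun x => ?f _) => apply: (computable_comp Y f)
  end).

Lemma computable_first_fail Y (n : nat -> nat) (P : nat -> pred nat) :
  computable Y n -> computable Y (fun z => P (pfst z) (psnd z)) ->
  computable Y (fun x => first_fail (P x) (n x)).
Proof.
move=> hn hP; rewrite /first_fail; computability.
have := computable_comp _ _ (fun z => npair (pfst z) (pfst (psnd z))) hP.
rewrite /comp /= => h; apply: (@eq_computable _ _ _ _ (h _)); last by computability.
by move=> z /=; rewrite pfst_npair psnd_npair.
Qed.

(** The code [c] is fixed, so induction on it takes the place of a universal machine. The parameter
    [u z], on which bound and oracle depend, is kept apart from the input, which changes inside
    loops. *)
Lemma computable_beval Y (s : nat -> nat) (o : nat -> pred nat) :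
  computable Y s ->
  (forall u x, computable Y u -> computable Y x -> computable Y (fun z => o (u z) (x z))) ->
  forall c u x, computable Y u -> computable Y x ->
    computable Y (fun z => beval c (s (u z)) (o (u z)) (x z)).
Proof.
move=> hs ho; elim=> [||||| f IHf g IHg | f IHf g IHg | f IHf g IHg | f IHf] u x hu hx /=;
  try by computability.
- by computability; apply: ho.
- by computability; (apply: IHf || apply: IHg); computability.
- by computability; try apply: IHf; try apply: IHg; computability; apply: IHg.
- by computability; (apply: IHf || apply: (IHg (fun z => u (pfst z)))); computability.
- have h : computable Y (fun z => first_fail (fun i => 1 < beval f (s (u z)) (o (u z)) (npair (x z) i)) (s (u z))).
    apply: computable_first_fail; first by computability.
    by computability; apply: (IHf (fun z => u (pfst z))); computability.
  by computability; apply: IHf; computability.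
Qed.

(* 0' decides Pi_1 predicates: the search for a counterexample halts iff one exists. *)
Lemma computable_forall_halting (P : nat -> pred nat) :
  computable set0 (fun z => P (pfst z) (psnd z)) ->
  computable halting_problem (fun x => `[< forall M, P x M >]).
Proof.
move=> [c hc].
(* [Mu c] halts exactly when some [P x M] has value 0, that is, when it fails. *)
apply: (@eq_computable _ (fun x => ~~ `[< halting_problem (npair (godel (Mu c)) x) >])).
  move=> x; congr nat_of_bool; rewrite -asbool_neg; apply: asbool_equiv_eq; split.
    move=> nh M; apply/negP => /negP nP; apply: nh.
    have exM : exists M, ~~ P x M by exists M.
    case: (ex_minnP exM) => m nPm hm; exists (Mu c), x, m; split=> //; split.
      by apply/hc; rewrite pfst_npair psnd_npair (negbTE nPm).
    move=> i im; exists 0; apply/hc; rewrite pfst_npair psnd_npair.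
    by case: (boolP (P x i)) => // /hm; rewrite leqNgt im.
  move=> h [c' [x' [v [/npair_inj2[/godel_inj <- <-] [/hc + _]]]]].
  by rewrite pfst_npair psnd_npair h.
apply: computable_negb; apply: computable_query.
exact: (computable_npair _ _ _ (computable_const _ _) (computable_id _)).
Qed.

(** * Digits and colourings *)

Definition digit (b d i : nat) : nat := (d %/ b.+1 ^ i) %% b.+1.

Lemma digit_surj b (f : nat -> nat) M : (forall i, f i <= b) ->
  exists2 d, d < b.+1 ^ M & forall i, i < M -> digit b d i = f i.
Proof.
move=> hf; elim: M => [|M [d dM hd]]; first by exists 0; rewrite ?expn0.
have b0 : 0 < b.+1 ^ M by rewrite expn_gt0.
exists (f M * b.+1 ^ M + d).
  rewrite expnS; apply: (@leq_trans (b * b.+1 ^ M + b.+1 ^ M)); last by rewrite mulSn addnC.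
  by rewrite -addnS leq_add // leq_mul2r hf orbT.
move=> i; rewrite ltnS leq_eqVlt => /orP[/eqP ->|iM].
  by rewrite /digit divnMDl // (divn_small dM) addn0 modn_small // ltnS.
(* Since [i < M], the new leading term remains a multiple of [b.+1] after division by [b.+1 ^ i], so
   it does not affect digit [i]. *)
rewrite -(hd _ iM) /digit; have -> : b.+1 ^ M = b.+1 ^ (M - i) * b.+1 ^ i.
  by rewrite -expnD subnK // ltnW.
rewrite mulnA divnMDl ?expn_gt0 //.
by rewrite -modnDml -(subnSK iM) expnSr mulnA modnMl.
Qed.

Lemma leq_digit b d i : digit b d i <= b.
Proof. by rewrite -ltnS ltn_mod. Qed.

(** This is König's lemma: keep extending a prefix that is compatible with valid colourings for
    arbitrarily large [M]. *)
Lemma coloring_compactness b (Q : nat -> (nat -> nat) -> Prop) :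
  (forall L c c', (forall i, i < L -> c i = c' i) -> Q L c -> Q L c') ->
  (forall M, exists2 c, forall i, c i <= b & forall L, L <= M -> Q L c) ->
  exists2 c, forall i, c i <= b & forall L, Q L c.
Proof.
move=> locQ finQ.
pose ext s := forall M, exists2 c, forall i, c i <= b &
  (forall L, L <= M -> Q L c) /\ forall i, i < size s -> c i = nth 0 s i.
have extS s : ext s -> exists j, j <= b /\ ext (rcons s j).
  move=> es; apply: contrapT => nj.
  have /choice[u hu] : forall j : nat, exists M, j <= b -> ~ exists2 c, forall i, c i <= b &
      (forall L, L <= M -> Q L c) /\ forall i, i < (size s).+1 -> c i = nth 0 (rcons s j) i.
    move=> j; have [jb|jb] := leqP j b; last by exists 0.
    apply: contrapT => nM; apply: nj; exists j; split=> // M.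
    apply: contrapT => nc; apply: nM; exists M => _ [c cb [cQ cs]]; apply: nc.
    by exists c => //; split=> // i; rewrite size_rcons; apply: cs.
  (* If each next colour [j] fails at a bound [u j], a colouring valid up to the largest of these
     bounds is contradictory. *)
  have [c cb [cQ cs]] := es (\max_(j < b.+1) u j).
  apply: (hu (c (size s))); first exact: cb.
  exists c => //; split=> [L Lu|i].
    apply: cQ; apply: (leq_trans Lu).
    have h : c (size s) < b.+1 by rewrite ltnS.
    exact: (leq_bigmax (Ordinal h)).
  rewrite ltnS leq_eqVlt nth_rcons => /orP[/eqP ->|il]; first by rewrite ltnn eqxx.
  by rewrite il cs.
have /choice[pick hpick] : forall s, exists j, ext s -> j <= b /\ ext (rcons s j).
  move=> s; have [/extS[j hj]|ns] := pselect (ext s); first by exists j.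
  by exists 0.
pose pre := fix pre n := if n is n'.+1 then rcons (pre n') (pick (pre n')) else [::].
have ext_pre n : ext (pre n).
  elim: n => [|n IH] /=; last by case: (hpick _ IH).
  by move=> M; have [c cb cQ] := finQ M; exists c => //; split.
have size_pre n : size (pre n) = n by elim: n => //= n IH; rewrite size_rcons IH.
have nth_pre n i : i < n -> nth 0 (pre n) i = pick (pre i).
  elim: n => //= n IH; rewrite ltnS leq_eqVlt nth_rcons size_pre => /orP[/eqP ->|il].
    by rewrite ltnn eqxx.
  by rewrite il IH.
exists (fun i => pick (pre i)) => [i|L]; first by case: (hpick _ (ext_pre i)).
have [c cb [cQ cs]] := ext_pre L L.
apply: locQ (cQ L (leqnn _)) => i iL.
by rewrite cs ?size_pre // nth_pre.
Qed.

Lemma finite_set_bound (S : set nat) : finite_set S -> exists u, forall i, S i -> i < u.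
Proof.
move=> /finite_seqP[s ->]; exists (\max_(i <- s) i).+1 => i /= hi.
by rewrite ltnS; apply: leq_bigmax_seq hi _.
Qed.

(** * Finite lists of numbers *)

(** A list is its length paired with its nested entries, the latest outermost; the length tells
    where the nesting ends. *)
Definition lsize (V : nat) : nat := pfst V.
Definition lmem (V t : nat) : bool :=
  has (fun i => pfst (iteri i (fun _ w => psnd w) (psnd V)) == t) (iota 0 (lsize V)).
Definition lnil : nat := npair 0 0.
Definition ladd (V t : nat) : nat := npair (lsize V).+1 (npair t (psnd V)).

Lemma lsize_add V t : lsize (ladd V t) = (lsize V).+1.
Proof. by rewrite /lsize /ladd pfst_npair. Qed.

Lemma lmem_nil t : lmem lnil t = false.
Proof. by rewrite /lmem /lsize /lnil pfst_npair. Qed.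

Lemma lmem_add V t r : lmem (ladd V t) r = (r == t) || lmem V r.
Proof.
rewrite /lmem lsize_add /ladd psnd_npair /= pfst_npair eq_sym; congr orb.
have iter_psnd w i : psnd (iteri i (fun=> psnd) w) = iteri i (fun=> psnd) (psnd w).
  by elim: i => //= i ->.
rewrite (iotaDl 1 0) has_map; apply: eq_has => i /=.
by rewrite iter_psnd psnd_npair.
Qed.

(** * The greedy enumeration *)

Definition outputs (U : code) (N L : nat) (o : pred nat) (t : nat) : bool :=
  has (fun q => beval U L o q == t.+1) (iota 0 N).

(* With D the set of outputs below L: |D u V| <= N, V being free of duplicates. *)
Definition fits (U : code) (N V L : nat) (o : pred nat) : bool :=
  lsize V + count (fun t => ~~ lmem V t && outputs U N L o t) (iota 0 L) <= N.

Definition mono (b : nat) (c : nat -> nat) (j : nat) (E : pred nat) : pred nat :=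
  fun i => [&& E i, b <= i & c i == j].

(* The bounded form of [good]: colourings of [0, M) and subsets of [0, L) are
   given by the digits of d and e. *)
Definition good_upto (U : code) (N b V M : nat) : bool :=
  has (fun d => all (fun L => all (fun j => all (fun e =>
         fits U N V L (mono b (digit b d) j (fun i => digit 1 e i == 1)))
       (iota 0 (2 ^ L))) (iota 0 b.+1)) (iota 0 M.+1)) (iota 0 (b.+1 ^ M)).

(** A single [b] bounds the colours and also marks the discarded initial segment, so that one number
    witnesses goodness. Only the part of [E] below [L] is consulted. *)
Definition good (U : code) (N b V : nat) : Prop :=
  exists2 c, forall i, c i <= b &
    forall L j (E : pred nat), j <= b -> fits U N V L (mono b c j E).

Lemma eq_fits U N V L o o' : (forall i, i < L -> o i = o' i) ->
  fits U N V L o = fits U N V L o'.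
Proof.
move=> e; rewrite /fits; congr (_ + _ <= _); apply: eq_count => t /=.
by congr andb; apply: eq_has => q /=; rewrite (eq_beval _ _ _ _ _ e).
Qed.

(** The condition at [L] depends only on the colouring and on [E] below [L], so compactness reduces
    it to finite colourings and finite sets, coded by digits. This is the Pi_1 form that 0' can
    decide. *)
Lemma goodP U N b V : good U N b V <-> forall M, good_upto U N b V M.
Proof.
split=> [[c cb hc] M|h].
  have [d dM hd] := digit_surj b c M cb.
  apply/hasP; exists d; first by rewrite mem_iota.
  apply/allP => L; rewrite mem_iota add0n ltnS => LM.
  apply/allP => j; rewrite mem_iota add0n ltnS => jb.
  apply/allP => e _; rewrite -(eq_fits _ _ _ _ (mono b c j (fun i => digit 1 e i == 1))).
    exact: hc.
  by move=> i iL; rewrite /mono hd //; lia.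
have [||c cb hc] := coloring_compactness b
  (fun L c => forall j (E : pred nat), j <= b -> fits U N V L (mono b c j E)).
- move=> L c c' e hc j E jb; rewrite -(eq_fits _ _ _ _ (mono b c j E)); first exact: hc.
  by move=> i iL; rewrite /mono e.
- move=> M; have /hasP[d _ hd] := h M; exists (digit b d) => [i|L LM j E jb].
    exact: leq_digit.
  have [|e eL he] := digit_surj 1 (fun i => E i) L; first by move=> i; case: (E i).
  move: hd => /allP/(_ L); rewrite mem_iota add0n ltnS => /(_ LM).
  move=> /allP/(_ j); rewrite mem_iota add0n ltnS => /(_ jb).
  move=> /allP/(_ e); rewrite mem_iota add0n => /(_ eL).
  rewrite (eq_fits _ _ _ _ _ (mono b (digit b d) j E)) // => i iL.
  by rewrite /mono he //; case: (E i).
- by exists c => // L j E; apply: hc.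
Qed.

(** Each of the [N] programs contributes at most one output, whatever the oracle. *)
Lemma good_nil U N : good U N 0 lnil.
Proof.
exists (fun=> 0) => // L j E _; set o := mono _ _ _ _.
rewrite /fits /lsize pfst_npair add0n -size_filter.
rewrite -[leqRHS](size_iota 0) -(size_map (fun q => (beval U L o q).-1) (iota 0 N)).
apply: uniq_leq_size; first by rewrite filter_uniq ?iota_uniq.
move=> t; rewrite mem_filter => /andP[/andP[_ /hasP[q qN /eqP hq]] _].
by apply/mapP; exists q => //; rewrite hq.
Qed.

Lemma good_lsize U N b V : good U N b V -> lsize V <= N.
Proof. by move=> [c _ /(_ 0 0 xpred0 (leq0n _))]; rewrite /fits addn0. Qed.

Definition described_by_all (U : code) (N : nat) (F : set (set nat)) (t : nat) : Prop :=
  forall Y, F Y -> exists2 q, q < N & eval Y U q t.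

Lemma good_ladd U N b V A t :
  described_by_all U N (infinite_subsets A `|` infinite_subsets (~` A)) t ->
  ~~ lmem V t -> good U N b V -> exists b', good U N b' (ladd V t).
Proof.
(* The parity of the refined colour [c'] records membership in [A]. *)
move=> ht tV [c cb hc]; pose c' i := (c i).*2 + `[< A i >].
have c'b i : c' i <= b.*2.+1 by rewrite /c'; have := cb i; case: asbool; lia.
have /choice[u hu] : forall j, exists u,
    finite_set [set i | c' i = j] -> forall i, c' i = j -> i < u.
  move=> j; have [/finite_set_bound[u hu]|] := pselect (finite_set [set i | c' i = j]).
    by exists u.
  by exists 0.
(* Beyond [b'] no finite class of [c'] has any element left. *)
pose b' := maxn b.*2.+1 (\max_(j < b.*2.+2) u j).
have bb' : b <= b' by rewrite /b'; lia.
have c'b' i : c' i <= b' by apply: leq_trans (leq_maxl _ _); exact: c'b.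
have infc' i0 : b' <= i0 -> infinite_set [set i | c' i = c' i0].
  move=> bi /hu/(_ i0 erefl); apply/negP; rewrite -leqNgt; apply: leq_trans bi.
  apply: leq_trans (leq_maxr _ _).
  have h : c' i0 < b.*2.+2 by rewrite ltnS.
  exact: (leq_bigmax (Ordinal h)).
exists b', c' => // L j E jb'; set o := mono _ _ _ _.
(* [i0] represents the class containing [o] below [L]; if [o] is empty there, [b'] itself serves. *)
have [i0 bi0 oi0] : exists2 i0, b' <= i0 & forall i, i < L -> o i -> c' i = c' i0.
  have [[i iL oi]|no] := pselect (exists2 i, i < L & o i).
    case/and3P: (oi) => _ bi /eqP ci; exists i => // k _ /and3P[_ _ /eqP ->].
    by rewrite ci.
  by exists b' => // i iL oi; case: no; exists i.
(* [Y] agrees with [o] below [L] and then takes the whole class of [i0] from [maxn L b'] on. *)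
pose Y := [set i | (i < L /\ o i) \/ [/\ L <= i, b' <= i & c' i = c' i0]].
have Yc' i : Y i -> b' <= i /\ c' i = c' i0.
  by move=> [[iL oi]|[]//]; split; [case/and3P: oi|exact: oi0].
have infY : infinite_set Y.
  move=> fY; apply: (infc' i0 bi0).
  apply: (@sub_finite_set _ _ (Y `|` `I_(maxn L b'))); last first.
    by rewrite finite_setU; split=> //; exact: finite_II.
  move=> i /= ci; have [h|h] := ltnP i (maxn L b'); first by right.
  by left; right; move: h; rewrite geq_max => /andP[].
have [q0 q0N hq0] : exists2 q, q < N & eval Y U q t.
  apply: ht; have [Ai0|Ai0] := pselect (A i0); [left|right]; split=> // i /Yc'[_].
    rewrite /c' (asboolT Ai0); case: (pselect (A i)) => // nA.
    by rewrite (asboolF nA); lia.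
  rewrite /c' (asboolF Ai0) /= => + Ai; rewrite (asboolT Ai); lia.
have [s0 hs0] := beval_complete_ltn Y U N.
(* [L'] lets all halting programs with oracle [Y] finish, and it exceeds [t] so that [t] is
   counted. *)
pose L' := maxn (maxn s0 L) t.+1.
(* For the old colouring, [Y] is monochromatic of colour [c i0] and lies above [b], so the goodness
   of [V] applies to it. *)
pose o' := mono b c (c i0) (fun i => `[< Y i >]).
have ho' i : i < L' -> o' i = `[< Y i >].
  move=> _; rewrite /o' /mono; case: asboolP => //= /Yc'[bi ci].
  rewrite (leq_trans bb' bi) /=; apply/eqP; move: ci; rewrite /c'.
  by case: asbool; case: asbool; lia.
have ho i : i < L -> o i = `[< Y i >].
  move=> iL; apply/idP/asboolP => [oi|[[//]|[]]]; first by left.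
  by rewrite leqNgt iL.
have out' r q : q < N -> eval Y U q r -> outputs U N L' o' r.
  move=> qN hq; apply/hasP; exists q; first by rewrite mem_iota.
  by rewrite (hs0 _ _ _ qN _ hq _ ho') // /L'; lia.
have : fits U N V L' o' by apply: hc; exact: cb.
(* The added element is moved into the count: [t] and the new outputs of [o] below [L] must all
   occur among the outputs of [o'] below [L']. *)
rewrite /fits lsize_add addSnnS; apply: leq_trans; rewrite leq_add2l.
rewrite -!size_filter.
set s := filter _ (iota 0 L); rewrite -[(size s).+1]/(size (t :: s)).
apply: uniq_leq_size.
  rewrite /= filter_uniq ?iota_uniq // andbT mem_filter lmem_add eqxx.
  by [].
move=> r; rewrite inE !mem_filter => /orP[/eqP ->|].
  by rewrite tV (out' _ q0) //= mem_iota /L'; lia.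
(* An output of [o] is a genuine output relative to [Y], the oracles agreeing below [L], and so it
   reappears at [L']. *)
rewrite lmem_add negb_or => /andP[/andP[/andP[_ rV]] /hasP[q qN /eqP hq]].
rewrite !mem_iota !add0n => rL; rewrite rV (out' _ q) /=.
- by rewrite /L'; lia.
- by move: qN; rewrite mem_iota.
- exact: beval_sound hq.
Qed.

(* Stage s, decoded as (_, (t, b)), appends t to the list if b witnesses that
   the result is good; every pair (t, b) is considered at arbitrarily late stages. *)
Definition stage (U : code) (N s V : nat) : nat :=
  if ~~ lmem V (pfst (psnd s)) &&
     `[< forall M, good_upto U N (psnd (psnd s)) (ladd V (pfst (psnd s))) M >]
  then ladd V (pfst (psnd s)) else V.

Definition greedy (U : code) (N s : nat) : nat := iteri s (stage U N) lnil.

Lemma greedyS U N s : greedy U N s.+1 = stage U N s (greedy U N s).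
Proof. by []. Qed.

Lemma greedy_good U N s : exists b, good U N b (greedy U N s).
Proof.
elim: s => [|s [b hb]]; first by exists 0; exact: good_nil.
rewrite greedyS /stage; case: ifP => [/andP[_ /asboolP h]|_]; last by exists b.
by exists (psnd (psnd s)); apply/goodP.
Qed.

Lemma lsize_greedy_le U N s s' : s <= s' -> lsize (greedy U N s) <= lsize (greedy U N s').
Proof.
elim: s' => [|s' IH]; first by rewrite leqn0 => /eqP ->.
rewrite leq_eqVlt => /orP[/eqP -> //|/IH h].
by apply: (leq_trans h); rewrite greedyS /stage; case: ifP; rewrite ?lsize_add.
Qed.

Lemma lmem_greedy U N s t : lmem (greedy U N s) t ->
  exists2 s', pfst (psnd s') = t &
    lsize (greedy U N s'.+1) = (lsize (greedy U N s')).+1.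
Proof.
elim: s => [|s IH]; first by rewrite lmem_nil.
rewrite greedyS {1}/stage; case: ifP => [h|_]; last exact: IH.
rewrite lmem_add => /orP[/eqP ->|]; last exact: IH.
by exists s; rewrite // greedyS {1}/stage h lsize_add.
Qed.

(** Goodness bounds all lengths by [N]; after a stage of maximal length nothing can be added. *)
Lemma greedy_stable U N : exists s0, forall s, s0 <= s -> greedy U N s = greedy U N s0.
Proof.
have exP : exists n, `[< exists s, lsize (greedy U N s) = n >].
  by exists (lsize (greedy U N 0)); apply/asboolP; exists 0.
have bP n : `[< exists s, lsize (greedy U N s) = n >] -> n <= N.
  by move=> /asboolP[s <-]; have [b /good_lsize] := greedy_good U N s.
case: (ex_maxnP exP bP) => n /asboolP[s0 hs0] hmax; exists s0.
elim=> [|s IH]; first by rewrite leqn0 => /eqP ->.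
rewrite leq_eqVlt => /orP[/eqP -> //|/IH e].
have : lsize (greedy U N s.+1) <= n by apply: hmax; apply/asboolP; exists s.+1.
rewrite greedyS /stage; case: ifP => [_|//].
by rewrite lsize_add e hs0 ltnn.
Qed.

Lemma greedy_complete U N A t :
  described_by_all U N (infinite_subsets A `|` infinite_subsets (~` A)) t ->
  exists s, lmem (greedy U N s) t.
Proof.
move=> ht; have [s0 hs0] := greedy_stable U N; exists s0; apply: contrapT => /negP nt.
have [b /(good_ladd _ _ _ _ _ _ ht nt)[b' /goodP hb']] := greedy_good U N s0.
(* This stage tests [t] with witness [b'], and it comes no earlier than [s0]; it would lengthen the
   stable list. *)
pose s := npair s0 (npair t b'); have s0s : s0 <= s by exact: leq_npairl.
have := congr1 lsize (hs0 s.+1 (leqW s0s)).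
rewrite greedyS /stage hs0 // !psnd_npair pfst_npair nt /= (asboolT hb') lsize_add.
by lia.
Qed.

(** * The machine *)

(* The largest number 2 ^ k - 1 that is at most x. *)
Definition threshold (x : nat) : nat :=
  iteri x (fun i w => if i == w.*2 then i.+1 else w) 0.

(** The accumulator [w = 2 ^ k - 1] is replaced at index [2 * w] by [2 * w + 1 = 2 ^ k.+1 - 1]. *)
Lemma thresholdE k x : (2 ^ k).-1 <= x < (2 ^ k.+1).-1 -> threshold x = (2 ^ k).-1.
Proof.
elim: x k => [|x IH] k; rewrite expnS; have h2 : 0 < 2 ^ k by rewrite expn_gt0.
  by move=> /andP[h _]; rewrite /threshold /=; lia.
move=> /andP[h1 h3]; rewrite /threshold iteriS -/(threshold x).
have [kx|xk] := leqP (2 ^ k).-1 x.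
  rewrite (IH k) ?expnS; last by lia.
  by case: eqP; lia.
case: k h1 h2 h3 xk IH => [|k]; first by rewrite expn0.
rewrite !expnS => h1 h2 h3 xk IH.
have h0 : 0 < 2 ^ k by rewrite expn_gt0.
rewrite (IH k) ?expnS; last by lia.
by case: eqP; lia.
Qed.

Lemma computable_lmem Y f g : computable Y f -> computable Y g ->
  computable Y (fun x => lmem (f x) (g x)).
Proof. by move=> hf hg; rewrite /lmem /lsize; computability. Qed.

Lemma computable_fits Y U N V L (o : nat -> pred nat) :
  computable Y N -> computable Y V -> computable Y L ->
  (forall u x, computable Y u -> computable Y x -> computable Y (fun z => o (u z) (x z))) ->
  computable Y (fun z => fits U (N z) (V z) (L z) (o z)).
Proof.
move=> hN hV hL ho; rewrite /fits /lsize /outputs; computability.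
- by apply: computable_lmem; computability.
- by apply: (computable_beval Y L o hL ho U (fun z => pfst (pfst z))); computability.
Qed.

Lemma computable_good_upto Y U N b V M :
  computable Y N -> computable Y b -> computable Y V -> computable Y M ->
  computable Y (fun z => good_upto U (N z) (b z) (V z) (M z)).
Proof.
move=> hN hb hV hM; rewrite /good_upto; computability.
apply: computable_fits; computability => u x hu hx.
by rewrite /mono /digit; computability.
Qed.

Lemma computable_stage U N s V : computable halting_problem N ->
  computable halting_problem s -> computable halting_problem V ->
  computable halting_problem (fun z => stage U (N z) (s z) (V z)).
Proof.
move=> hN hs hV; rewrite /stage.
have hadd : computable halting_problem (fun z => ladd (V z) (pfst (psnd (s z)))).
  by rewrite /ladd /lsize; computability.
computability; first by apply: computable_lmem; computability.
(* The arguments of the Pi_1 test are packed into one number, as the query to 0' requires. *)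
pose P x M := good_upto U (pfst x) (pfst (psnd x)) (psnd (psnd x)) M.
have hP : computable halting_problem (fun x => `[< forall M, P x M >]).
  by apply: computable_forall_halting; apply: computable_good_upto; computability.
have := computable_comp _ _ (fun z => npair (N z) (npair (psnd (psnd (s z)))
  (ladd (V z) (pfst (psnd (s z)))))) hP.
rewrite /P => h; apply: (@eq_computable _ _ _ _ (h _)); last by computability.
by move=> z /=; rewrite !(pfst_npair, psnd_npair).
Qed.

Lemma computable_greedy U N s : computable halting_problem N ->
  computable halting_problem s ->
  computable halting_problem (fun z => greedy U (N z) (s z)).
Proof.
move=> hN hs; rewrite /greedy; computability.
by apply: computable_stage; computability.
Qed.

Lemma computable_threshold Y f : computable Y f -> computable Y (fun x => threshold (f x)).
Proof.
move=> hf; rewrite /threshold.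
apply: (@eq_computable _ (fun x => iteri (f x) (fun i w => if i == w + w then i.+1 else w) 0)).
  by move=> x; apply: eq_iteri => i w; rewrite addnn.
by computability.
Qed.

(** With [N = 2 ^ k - 1] and [i < N], the threshold of [N + i] is [N], so the input determines both
    [N] and [i]. The machine searches for the first stage after which the list has more than [i]
    elements and outputs the number added there. *)
Lemma greedy_machine (U : code) : exists Mc : code, forall k s t,
  pfst (psnd s) = t ->
  lsize (greedy U (2 ^ k).-1 s.+1) = (lsize (greedy U (2 ^ k).-1 s)).+1 ->
  eval halting_problem Mc ((2 ^ k).-1 + lsize (greedy U (2 ^ k).-1 s)) t.
Proof.
(* The value at [npair (N + i) s] is 0 exactly when the list after stage [s] has at least [i.+1]
   elements. *)
have [c hc] : computable halting_problem (fun z =>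
    (pfst z - threshold (pfst z)).+1 - lsize (greedy U (threshold (pfst z)) (psnd z).+1)).
  have ht := computable_threshold halting_problem _ (computable_id _).
  rewrite /lsize; computability.
  by apply: computable_greedy; computability.
exists (Comp (Comp Fst Snd) (Mu c)) => k s t hs hsize.
set N := (2 ^ k).-1 in hsize *; set i := lsize _.
have iN : i < N.
  by have [b /good_lsize] := greedy_good U N s.+1; rewrite hsize.
have thr : threshold (N + i) = N.
  by apply: thresholdE; rewrite expnS; move: iN; rewrite /N; lia.
exists s; last first.
  by exists (psnd s); [exists (pfst s)|exists (psnd (psnd s))]; rewrite -?hs npairK.
split.
  apply/hc; rewrite pfst_npair psnd_npair thr addKn hsize; lia.
move=> m ms; exists (i - lsize (greedy U N m.+1)); apply/hc.
rewrite pfst_npair psnd_npair thr addKn subSn //.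
exact: lsize_greedy_le.
Qed.

Theorem theorem6p5 (U : code) (hU : optimal U) :
  exists c : nat, forall (sigma : seq bool) (A : set nat),
    plainC U halting_problem sigma
      <= plainC_family U (infinite_subsets A `|` infinite_subsets (~` A)) sigma + c.
Proof.
have [Mc hMc] := greedy_machine U; have [k hk] := hU Mc.
(* [k] is the cost of simulating [Mc] on [U]; the extra 1 arises because the program given to [Mc]
   has length [n.+1]. *)
exists k.+1 => sigma A; set F := _ `|` _; set n := plainC_family _ _ _.
have [_ hF] := plainC_familyP hU (infinite_subsetsUC_neq0 A) sigma.
have hdesc : described_by_all U (2 ^ n.+1).-1 F (str_num sigma).
  move=> Y FY; have [[q qn hq] _] := plainCP hU Y sigma.
  exists (str_num q) => //; have /andP[_ h] := str_num_bounds q.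
  apply: (leq_trans h); have : 2 ^ (size q).+1 <= 2 ^ n.+1.
    by rewrite leq_exp2l // ltnS qn hF.
  by lia.
have [s0 /lmem_greedy[s hs hsize]] := greedy_complete _ _ _ _ hdesc.
have := hMc _ _ _ hs hsize; set x := _ + _ => hx.
(* With [N = 2 ^ n.+1 - 1], the numbers from [N] to [2 * N] are those of the strings of length
   [n.+1], and the position in the list is below [N]. *)
have xb : (2 ^ n.+1).-1 <= x < (2 ^ n.+2).-1.
  rewrite leq_addr /= /x [2 ^ n.+2]expnS; have [b /good_lsize] := greedy_good U (2 ^ n.+1).-1 s.+1.
  by rewrite hsize; lia.
have [p hp px] := str_num_surj_size _ _ xb.
have [|q qp hq] := hk halting_problem p sigma; first by rewrite /run px.
have [_ hC] := plainCP hU halting_problem sigma.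
by apply: (leq_trans (hC _ hq)); rewrite hp in qp; lia.
Qed.
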